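(* Let $d\ge 1$ be an integer and $\varepsilon\in(0,1)$. Let $G$ be a finite abelian group, $A\subseteq G$, and $\delta=|A|/|G|$. (i) If $A$ is $\varepsilon$-uniform of degree $d$, i.e. $\|A-\delta\|_{U^{d+1}}\le\varepsilon$, then for every integer $k\ge d+1$ the Cayley hypergraph $\Gamma^{(k)}_A$ is $\varepsilon$-quasirandom of order $d$, i.e. $\|\Gamma^{(k)}_A-\delta\|_{\square^k_d}\le\varepsilon$. (ii) Conversely, if for some integer $k\ge d+1$ the hypergraph $\Gamma^{(k)}_A$ is $\varepsilon$-quasirandom of order $d$, then $A$ is $2\varepsilon^{c_{k,d}}$-uniform of degree $d$, i.e. $\|A-\delta\|_{U^{d+1}}\le 2\varepsilon^{c_{k,d}}$, where $c_{k,d}=2^{-(d+2)(2d+2)^k}$.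
   Context: Sets are identified with their indicator functions; $\mathbb{E}_{x\in X}$ denotes the average $|X|^{-1}\sum_{x\in X}$. For a finite abelian group $G$, an integer $m\ge 2$ and $f:G\to\mathbb{R}$, the Gowers uniformity norm is $\|f\|_{U^m}=\big(\mathbb{E}_{x,h_1,\dots,h_m\in G}\prod_{\omega\in\{0,1\}^m} f(x+\sum_{i=1}^m\omega_ih_i)\big)^{1/2^m}$. For $A\subseteq G$ with $\delta=|A|/|G|$, $A$ is called $\varepsilon$-uniform of degree $d$ if $\|A-\delta\|_{U^{d+1}}\le\varepsilon$. For integers $1\le d<k$, a finite set $V$ and $f:V^k\to\mathbb{R}$, the $d$-cut norm is $\|f\|_{\square^k_d}=\max\big|\mathbb{E}_{\mathbf{x}\in V^{k}}\big[f(\mathbf{x})\prod_{B\in\binom{[k]}{d}}S_B(\mathbf{x}_B)\big]\big|$, the maximum taken over all families of subsets $S_B\subseteq V^B$ ($B\in\binom{[k]}{d}$), where $\mathbf{x}_B=(x_j)_{j\in B}$. The Cayley $k$-graph $\Gamma^{(k)}_A$ of $A\subseteq G$ has vertex set $G$ and edge indicator function $\Gamma^{(k)}_A(x_1,\dots,x_k)=A(x_1+\dots+x_k)$ on $G^k$ (hypergraphs are allowed to have loops, i.e. edges are a symmetric subset of $V^k$); its edge density is $\delta=|A|/|G|$. A $k$-graph $H$ with edge density $\delta(H)$ is $\varepsilon$-quasirandom of order $d$ if $\|H-\delta(H)\|_{\square^k_d}\le\varepsilon$, where $H$ denotes its edge indicator function on $V(H)^k$. *)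

(* Defs.v *)
From HB Require Import structures.
From mathcomp Require Import all_boot all_order all_algebra.
From mathcomp Require Import reals exp.
Set Implicit Arguments.
Unset Strict Implicit.
Unset Printing Implicit Defensive.
Import Order.TTheory GRing.Theory Num.Theory.
Local Open Scope ring_scope.

Section Defs.
Variable R : realType.

Definition avg (T : finType) (f : T -> R) : R :=
  (#|T|%:R)^-1 * \sum_(x : T) f x.

Definition gowers (G : finZmodType) (m : nat) (f : G -> R) : R :=
  powR (avg (fun x : G => avg (fun h : {ffun 'I_m -> G} =>
          \prod_(w : {ffun 'I_m -> bool})
             f (x + \sum_(i < m) (if w i then h i else 0)))))
       ((2 ^ m)%:R)^-1.

Definition density (G : finType) (A : {set G}) : R := #|A|%:R / #|G|%:R.

Definition balanced (G : finType) (A : {set G}) (x : G) : R :=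
  (x \in A)%:R - density A.

(* S : {set {ffun 'I_k -> V}} depends only on the coordinates in B,
   i.e. it is (the cylinder over) a subset S_B of V^B. *)
Definition depends_only_on (k : nat) (V : finType) (B : {set 'I_k})
    (S : {set {ffun 'I_k -> V}}) : bool :=
  [forall x : {ffun 'I_k -> V}, forall y : {ffun 'I_k -> V},
     [forall i in B, x i == y i] ==> ((x \in S) == (y \in S))].

Definition cut_family (k d : nat) (V : finType)
    (S : {ffun {set 'I_k} -> {set {ffun 'I_k -> V}}}) : bool :=
  [forall B : {set 'I_k}, (#|B| == d) ==> depends_only_on B (S B)].

Definition cutnorm (k d : nat) (V : finType) (f : {ffun 'I_k -> V} -> R) : R :=
  \big[Num.max/0]_(S | cut_family d S)
     `| avg (fun x : {ffun 'I_k -> V} =>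
          f x * \prod_(B : {set 'I_k} | #|B| == d) (x \in S B)%:R) |.

Definition cayley (G : finZmodType) (k : nat) (A : {set G})
    (x : {ffun 'I_k -> G}) : R :=
  ((\sum_(i < k) x i) \in A)%:R.

Definition ckd (k d : nat) : R :=
  powR 2 (- ((d + 2) * (2 * d + 2) ^ k)%N%:R).

End Defs.

(* Main.v *)
Require Import Defs.
From HB Require Import structures.
From mathcomp Require Import all_boot all_order all_algebra.
From mathcomp Require Import reals exp.
From mathcomp Require Import ring lra zify.
Set Implicit Arguments.
Unset Strict Implicit.
Unset Printing Implicit Defensive.
Import Order.TTheory GRing.Theory Num.Theory.
Local Open Scope ring_scope.

(** Let [f] be the balanced function of [A] and [m = d + 1]. Part (i) is [m] applications
    of Cauchy-Schwarz, one for each of [m] coordinates, since a [d]-set always misses one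
    of them.

    For part (ii), call [g : G -> R] structured on a set [I] of coordinates if
    [g (c + \sum_(i in I) x i)] behaves like an average of products of bounded functions of
    at most [d] variables; every bounded [g] is structured when [#|I| <= d]. If [F w] is
    structured on [{i in I | w (p i) = 0}] for all [w != 0], where [p] maps [I] to the [m]
    directions of the cube, then the dual function
    [c |-> E_h \prod_(w != 0) F w (c + w . h)] is structured on [I]: substitute
    [h j - \sum_(p i = j) x i] for [h j]. Starting from the cube average of [f], the copies
    of [f] at [w != 0] are replaced one at a time: the dual function [H] at [w] correlates
    with itself, hence has large uniformity norm, and by induction on [#|I|] it correlates
    with a function structured on the smaller set. At the end [f] correlates with a function
    structured on all [k] coordinates, which bounds the cut norm from below. Letting [p] be
    injective except on the fibre of one direction, only the [w] vanishing in that direction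
    cost anything, and the exponents sum to the stated one. *)

(** * Averages over finite types: convexity and Cauchy-Schwarz *)

Section Averages.
Variable R : realType.
Implicit Types T S : finType.

Lemma eq_avg T (f g : T -> R) : f =1 g -> avg f = avg g.
Proof. by move=> fg; rewrite /avg; congr (_ * _); apply: eq_bigr. Qed.

Lemma avgZl T c (f : T -> R) : avg (fun x => c * f x) = c * avg f.
Proof. by rewrite /avg -mulr_sumr mulrCA. Qed.

Lemma avgZr T c (f : T -> R) : avg (fun x => f x * c) = avg f * c.
Proof. by rewrite mulrC -avgZl; apply: eq_avg => x; rewrite mulrC. Qed.

Lemma avgD T (f g : T -> R) : avg (fun x => f x + g x) = avg f + avg g.
Proof. by rewrite /avg big_split mulrDr. Qed.

Lemma avg_cst T (x0 : T) (c : R) : avg (fun _ : T => c) = c.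
Proof.
rewrite /avg sumr_const -[c *+ _]mulr_natl mulrA mulVf ?mul1r //.
by rewrite pnatr_eq0 -lt0n; apply/card_gt0P; exists x0.
Qed.

Lemma exchange_avg T S (f : T -> S -> R) :
  avg (fun x => avg (f x)) = avg (fun y => avg (f^~ y)).
Proof.
rewrite /avg -!mulr_sumr exchange_big /= mulrCA; congr (_ * _).
Qed.

Lemma reindex_avg T S (h : S -> T) (f : T -> R) :
  bijective h -> avg f = avg (f \o h).
Proof.
move=> bh; rewrite /avg (bij_eq_card bh) (reindex h) //=.
exact: onW_bij.
Qed.

Lemma avg_pair T S (F : T * S -> R) :
  avg F = avg (fun x => avg (fun y => F (x, y))).
Proof.
rewrite /avg card_prod natrM invfM -mulr_sumr pair_bigA /= mulrA.
by congr (_ * _); apply: eq_bigr => -[].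
Qed.

Lemma ler_avg T (f g : T -> R) : (forall x, f x <= g x) -> avg f <= avg g.
Proof.
by move=> fg; rewrite /avg ler_wpM2l ?invr_ge0 ?ler0n // ler_sum.
Qed.

Lemma norm_avg_le T (x0 : T) (f : T -> R) M :
  (forall x, `|f x| <= M) -> `|avg f| <= M.
Proof.
move=> fM; rewrite ler_norml -(avg_cst x0 M) -mulN1r -avgZl.
by apply/andP; split; apply: ler_avg => x; have := fM x; rewrite ler_norml ?mulN1r => /andP[].
Qed.

Lemma sqr_avg_le T (x0 : T) (f : T -> R) : avg f ^+ 2 <= avg (fun x => f x ^+ 2).
Proof.
have : 0 <= avg (fun x => (f x - avg f) ^+ 2).
  by rewrite -(avg_cst x0 0); apply: ler_avg => x; apply: sqr_ge0.
rewrite (eq_avg (g := fun x => f x ^+ 2 + (- (avg f *+ 2) * f x + avg f ^+ 2))).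
  by rewrite !avgD avgZl avg_cst //; move: (avg f) (avg _) => a b; nra.
by move=> x; ring.
Qed.

Lemma pow2_avg_le T (x0 : T) (f : T -> R) n :
  avg f ^+ (2 ^ n) <= avg (fun x => f x ^+ (2 ^ n)).
Proof.
elim: n f => [|n IH] f; first by rewrite expr1 lexx.
rewrite expnS exprM [leRHS](eq_avg (g := fun x => (f x ^+ 2) ^+ (2 ^ n))); last first.
  by move=> x; rewrite exprM.
apply: le_trans (IH _); apply: lerXn2r; rewrite ?nnegrE ?sqr_ge0 //.
  by apply: le_trans (sqr_avg_le x0 f); apply: sqr_ge0.
exact: sqr_avg_le.
Qed.

Lemma sqr_avgM_le T (x0 : T) (u f : T -> R) : (forall x, `|u x| <= 1) ->
  avg (fun x => u x * f x) ^+ 2 <= avg (fun x => f x ^+ 2).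
Proof.
move=> u1; apply: le_trans (sqr_avg_le x0 _) _; apply: ler_avg => x.
rewrite exprMn ler_piMl ?sqr_ge0 // -real_normK ?num_real //.
by rewrite exprn_ile1 ?u1.
Qed.

Lemma bounded_prod (I : Type) (r : seq I) (P : pred I) (F : I -> R) :
  (forall i, P i -> `|F i| <= 1) -> `|\prod_(i <- r | P i) F i| <= 1.
Proof.
move=> F1; rewrite normr_prod; apply: prodr_ile1 => i Pi.
by rewrite normr_ge0 F1.
Qed.

End Averages.

(** * Translations of [G] and of single coordinates of [G^k] *)

Section Shifts.
Variables (R : realType) (G : finZmodType).

Lemma avg_shift (f : G -> R) c : avg (fun x => f (x + c)) = avg f.
Proof.
symmetry; apply: (reindex_avg (h := fun x => x + c)).
by exists (fun x => x - c) => x; rewrite ?addrK ?subrK.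
Qed.

Definition shift (k : nat) (j : 'I_k) (t : G) (x : {ffun 'I_k -> G}) :=
  [ffun i => x i + (if i == j then t else 0)].

Lemma sum_shift k (j : 'I_k) t x : \sum_i shift j t x i = \sum_i x i + t.
Proof.
under eq_bigr do rewrite ffunE.
by rewrite big_split /= -big_mkcond big_pred1_eq.
Qed.

Lemma shiftD k (j : 'I_k) t s x : shift j s (shift j t x) = shift j (t + s) x.
Proof. by apply/ffunP=> i; rewrite !ffunE -addrA; case: eqP; rewrite ?addr0. Qed.

Lemma shift0 k (j : 'I_k) x : shift j 0 x = x.
Proof. by apply/ffunP=> i; rewrite !ffunE if_same addr0. Qed.

Lemma shiftC k (i j : 'I_k) t s x : shift i s (shift j t x) = shift j t (shift i s x).
Proof. by apply/ffunP=> l; rewrite !ffunE addrAC. Qed.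

Lemma avg_shiftf k (j : 'I_k) t (f : {ffun 'I_k -> G} -> R) :
  avg (fun x => f (shift j t x)) = avg f.
Proof.
symmetry; apply: (reindex_avg (h := shift j t)).
by exists (shift j (- t)) => x; rewrite shiftD ?addNr ?addrN shift0.
Qed.

(** Shifting coordinate [j] by [t] adds [t] to the sum, so a further average over [t] makes the sum
    uniform on [G]. *)
Lemma avg_sum_coord k (j : 'I_k) (f : G -> R) :
  avg (fun x : {ffun 'I_k -> G} => f (\sum_i x i)) = avg f.
Proof.
rewrite -(avg_cst (0 : G) (avg _)).
rewrite (eq_avg (g := fun t => avg (fun x : {ffun 'I_k -> G} => f (t + \sum_i x i)))).
  rewrite exchange_avg (eq_avg (g := fun _ => avg f)); last by move=> x; apply: avg_shift.
  exact: (avg_cst [ffun _ => 0]).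
by move=> t; rewrite -(avg_shiftf j t); apply: eq_avg => x; rewrite sum_shift addrC.
Qed.

End Shifts.

(** * Splitting off the first direction of a cube *)

Section FfunCons.
Variables (T : finType) (m : nat).

Definition ffcons (p : T * {ffun 'I_m -> T}) : {ffun 'I_m.+1 -> T} :=
  [ffun i => if unlift ord0 i is Some j then p.2 j else p.1].

Lemma ffcons0 p : ffcons p ord0 = p.1.
Proof. by rewrite ffunE unlift_none. Qed.

Lemma ffconsS p j : ffcons p (lift ord0 j) = p.2 j.
Proof. by rewrite ffunE liftK. Qed.

Lemma ffcons_bij : bijective ffcons.
Proof.
exists (fun x : {ffun 'I_m.+1 -> T} =>
  (x ord0, [ffun j : 'I_m => x (lift ord0 j)])) => [[t h]|x].
  by rewrite ffcons0; congr pair; apply/ffunP=> j; rewrite ffunE ffconsS.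
by apply/ffunP=> i; rewrite ffunE; case: unliftP => [j|] -> //=; rewrite ffunE.
Qed.

End FfunCons.

(** * Cube averages and iterated Cauchy-Schwarz *)

Section GowersForm.
Variables (R : realType) (G : finZmodType).

Definition cube m (w : {ffun 'I_m -> bool}) (h : {ffun 'I_m -> G}) : G :=
  \sum_(i < m) (if w i then h i else 0).

Definition gform m (F : {ffun 'I_m -> bool} -> G -> R) : R :=
  avg (fun x : G => avg (fun h : {ffun 'I_m -> G} => \prod_w F w (x + cube w h))).

Lemma cube_ffcons m b (w : {ffun 'I_m -> bool}) t (h : {ffun 'I_m -> G}) :
  cube (ffcons (b, w)) (ffcons (t, h)) = (if b then t else 0) + cube w h.
Proof.
rewrite /cube big_ord_recl !ffcons0 /=; congr (_ + _).
by apply: eq_bigr => i _; rewrite !ffconsS.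
Qed.

Lemma gform0 (f : G -> R) : gform (m := 0) (fun _ => f) = avg f.
Proof.
apply: eq_avg => x; rewrite -[RHS](avg_cst (finfun (fun _ : 'I_0 => 0 : G))).
apply: eq_avg => h; rewrite (big_pred1 (finfun (fun _ : 'I_0 => false))).
  by rewrite /cube big_ord0 addr0.
by move=> w /=; apply/esym/eqP/ffunP => -[].
Qed.

(** Pairing the two values of the first bit of [w] turns [f] into its multiplicative derivative in
    direction [t]. *)
Lemma gformS m (f : G -> R) :
  gform (m := m.+1) (fun _ => f) =
  avg (fun t => gform (m := m) (fun _ y => f y * f (y + t))).
Proof.
rewrite /gform [LHS]exchange_avg (reindex_avg _ (ffcons_bij G m)).
rewrite avg_pair /=; apply: eq_avg => t; rewrite exchange_avg.
apply: eq_avg => x; apply: eq_avg => h.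
rewrite (reindex (@ffcons bool m)); last exact/onW_bij/ffcons_bij.
rewrite -(pair_bigA _ (fun b w => f (x + cube (ffcons (b, w)) (ffcons (t, h))))) /=.
rewrite big_bool /= -big_split /=; apply: eq_bigr => w _.
by rewrite !cube_ffcons /= add0r mulrC [t + _]addrC addrA.
Qed.

(** Since [v] ignores coordinate [j], [F] may first be averaged over shifts of it. Cauchy-Schwarz
    then removes [v]; expanding the square gives two shifts, one of which translation invariance
    absorbs. *)
Lemma cauchy_schwarz_coord k (j : 'I_k) (v F : {ffun 'I_k -> G} -> R) :
  (forall x, `|v x| <= 1) -> (forall t x, v (shift j t x) = v x) ->
  avg (fun x => v x * F x) ^+ 2 <=
  avg (fun t => avg (fun x => F x * F (shift j t x))).
Proof.
move=> v1 vj.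
have -> : avg (fun x => v x * F x) =
    avg (fun x => v x * avg (fun t => F (shift j t x))).
  rewrite -(avg_cst (0 : G) (avg _)).
  rewrite (eq_avg (g := fun t => avg (fun x => v x * F (shift j t x)))).
    by rewrite exchange_avg; apply: eq_avg => x; rewrite avgZl.
  by move=> t; rewrite -(avg_shiftf j t); apply: eq_avg => x; rewrite vj.
apply: le_trans (sqr_avgM_le [ffun _ => 0] _ v1) _.
rewrite le_eqVlt; apply/orP; left; apply/eqP.
transitivity (avg (fun x => avg (fun s => avg (fun t =>
    F (shift j s x) * F (shift j t (shift j s x)))))).
  apply: eq_avg => x; rewrite expr2 -avgZr; apply: eq_avg => s.
  rewrite -avgZl -(avg_shift _ s); apply: eq_avg => t.
  by rewrite shiftD [s + t]addrC.
rewrite exchange_avg -[RHS](avg_cst (0 : G)); apply: eq_avg => s.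
by rewrite (avg_shiftf j s (fun x => avg (fun t => F x * F (shift j t x)))) exchange_avg.
Qed.

(* Iterating Cauchy-Schwarz over the coordinates in [s], each step trading one
   factor [v j] for a difference operator on [f]. *)
Lemma gform_dominates k (s : seq 'I_k) (f : G -> R)
    (v : 'I_k -> {ffun 'I_k -> G} -> R) : (0 < k)%N ->
  (forall j x, `|v j x| <= 1) -> (forall j t x, v j (shift j t x) = v j x) ->
  avg (fun x : {ffun 'I_k -> G} => f (\sum_i x i) * \prod_(j <- s) v j x)
    ^+ (2 ^ size s)
  <= gform (m := size s) (fun _ => f).
Proof.
move=> k0; elim: s f v => [|j s IH] f v v1 vj.
  rewrite expr1 gform0 -(avg_sum_coord (Ordinal k0)) le_eqVlt; apply/orP; left.
  by apply/eqP/eq_avg => x; rewrite big_nil mulr1.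
rewrite /= gformS expnS exprM.
pose F (x : {ffun 'I_k -> G}) := f (\sum_i x i) * \prod_(j <- s) v j x.
pose a t := avg (fun x => F x * F (shift j t x)).
rewrite (eq_avg (g := fun x => v j x * F x)); last first.
  by move=> x; rewrite big_cons mulrCA.
have CS := cauchy_schwarz_coord F (v1 j) (vj j).
apply: (@le_trans _ _ (avg a ^+ (2 ^ size s))).
  by apply: lerXn2r; rewrite ?nnegrE ?sqr_ge0 // (le_trans _ CS) ?sqr_ge0.
apply: le_trans (pow2_avg_le (0 : G) _ _) _; apply: ler_avg => t.
(* Differencing along [j] keeps the shape: each [v' i] still ignores coordinate [i], so the
   induction hypothesis applies for every [t]. *)
pose v' i (x : {ffun 'I_k -> G}) := v i x * v i (shift j t x).
rewrite /a (eq_avg (g := fun x : {ffun 'I_k -> G} =>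
    (fun y => f y * f (y + t)) (\sum_i x i) * \prod_(i <- s) v' i x)).
  apply: IH => [i x|i r x]; first by rewrite normrM mulr_ile1.
  by rewrite /v' shiftC !vj.
by move=> x; rewrite /F /v' sum_shift big_split /= mulrACA.
Qed.

End GowersForm.

Lemma cube_neq0 m (w : {ffun 'I_m -> bool}) : w != [ffun _ => false] -> exists i, w i.
Proof.
case: (pickP w) => [i wi _|w0 /eqP[]]; first by exists i.
by apply/ffunP => i; rewrite ffunE w0.
Qed.

(** * Cut functions, multipliers and dual functions *)

Section CutFunctions.
Variables (R : realType) (G : finZmodType).
Local Notation X k := {ffun 'I_k -> G}.

Definition cylinder k (B : {set 'I_k}) (u : X k -> R) : Prop :=
  forall x y : X k, (forall i, i \in B -> x i = y i) -> u x = u y.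

Definition cut_functions k d (u : {set 'I_k} -> X k -> R) : Prop :=
  forall B : {set 'I_k}, #|B| = d -> cylinder B (u B) /\ (forall x, `|u B x| <= 1).

Definition cut_prod k d (u : {set 'I_k} -> X k -> R) (x : X k) : R :=
  \prod_(B : {set 'I_k} | #|B| == d) u B x.

Lemma norm_le_powR (a U : R) m :
  a ^+ (2 ^ m.+1) <= U -> `|a| <= powR U ((2 ^ m.+1)%:R)^-1.
Proof.
move=> aU; have N0 : (2 ^ m.+1)%:R != 0 :> R by rewrite pnatr_eq0 expn_eq0.
have aN : `|a| ^+ (2 ^ m.+1) = a ^+ (2 ^ m.+1).
  by rewrite expnS !exprM real_normK ?num_real.
have -> : `|a| = powR (a ^+ (2 ^ m.+1)) ((2 ^ m.+1)%:R)^-1.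
  by rewrite -aN -powR_mulrn // -powRrM mulfV // powRr1.
rewrite ge0_ler_powR ?invr_ge0 ?ler0n ?nnegrE //.
  by rewrite -aN exprn_ge0.
by apply: le_trans aU; rewrite -aN exprn_ge0.
Qed.

(** Grouping the factors [u B] by a coordinate outside [B] gives one bounded function per chosen
    coordinate that ignores it, as [gform_dominates] requires. *)
Lemma cut_prod_le_gowers k d (f : G -> R) u : (d < k)%N -> cut_functions d u ->
  `|avg (fun x : X k => f (\sum_i x i) * cut_prod d u x)| <= gowers d.+1 f.
Proof.
move=> dk uP; apply: norm_le_powR; rewrite -/(gform (fun _ => f)).
pose s := [seq widen_ord dk i | i <- enum 'I_d.+1].
have ss : size s = d.+1 by rewrite size_map size_enum_ord.
have us : uniq s.
  by rewrite map_inj_uniq ?enum_uniq // => i j [] ij; apply: val_inj.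
pose j0 : 'I_k := Ordinal (leq_ltn_trans (leq0n d) dk).
(* The default [j0] is never reached for a [d]-set, as [s] has [d + 1] distinct elements. *)
pose jB (B : {set 'I_k}) := odflt j0 [pick i | (i \in s) && (i \notin B)].
have jBP (B : {set 'I_k}) : #|B| = d -> (jB B \in s) && (jB B \notin B).
  rewrite /jB; case: pickP => //= nB cB.
  suff : (size s <= d)%N by rewrite ss ltnn.
  rewrite -cB -(card_uniqP us); apply/subset_leq_card/subsetP => i is_.
  by have := nB i; rewrite /= is_ /= => /negbFE.
pose v (j : 'I_k) (x : X k) := \prod_(B : {set 'I_k} | (#|B| == d) && (jB B == j)) u B x.
have v1 j x : `|v j x| <= 1.
  by apply: bounded_prod => B /andP[/eqP /uP[_ ub] _].
have vj j t x : v j (shift j t x) = v j x.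
  apply: eq_bigr => B /andP[/eqP cB /eqP jE].
  apply: (uP B cB).1 => i iB; rewrite ffunE; case: eqP => [ij|]; last by rewrite addr0.
  by have := jBP B cB; rewrite jE -ij iB andbF.
have := gform_dominates s f (leq_ltn_trans (leq0n d) dk) v1 vj; rewrite ss.
congr (_ ^+ _ <= _); apply: eq_avg.
move=> x; congr (_ * _); rewrite /v /cut_prod.
rewrite (exchange_big_dep (fun B : {set 'I_k} => #|B| == d)) /=; last by move=> j B _ /andP[].
apply: eq_bigr => B /eqP cB.
have /andP[js _] := jBP B cB.
by rewrite -big_filter (eq_filter (a2 := pred1 (jB B))) ?filter_pred1_uniq ?big_seq1 //
  => j /=; rewrite cB eqxx eq_sym.
Qed.

(* Stands for: [F] is an average of products of bounded functions of at most [d]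
   variables. In this form, closure under products and averages needs no bookkeeping. *)
Definition cut_multiplier k d (F : X k -> R) : Prop :=
  forall (W : X k -> R) M,
    (forall u, cut_functions d u -> `|avg (fun x => W x * cut_prod d u x)| <= M) ->
    forall u, cut_functions d u -> `|avg (fun x => W x * F x * cut_prod d u x)| <= M.

Lemma eq_cut_multiplier k d (F F' : X k -> R) :
  F =1 F' -> cut_multiplier d F -> cut_multiplier d F'.
Proof.
move=> FF' FP W M WM u uP; rewrite (eq_avg (g := fun x => W x * F x * cut_prod d u x)).
  exact: FP.
by move=> x; rewrite FF'.
Qed.

Lemma cut_multiplier1 k d : cut_multiplier (k := k) d (fun _ => 1).
Proof.
move=> W M WM u uP; rewrite (eq_avg (g := fun x => W x * cut_prod d u x)); first exact: WM.
by move=> x; rewrite mulr1.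
Qed.

Lemma cut_multiplierM k d (F F' : X k -> R) :
  cut_multiplier d F -> cut_multiplier d F' -> cut_multiplier d (fun x => F x * F' x).
Proof.
move=> FP F'P W M WM u uP.
rewrite (eq_avg (g := fun x => W x * F x * F' x * cut_prod d u x)).
  by apply: F'P => // u' u'P; apply: FP.
by move=> x; rewrite !mulrA.
Qed.

Lemma cut_multiplier_prod k d (I : Type) (r : seq I) (P : pred I) (F : I -> X k -> R) :
  (forall i, P i -> cut_multiplier d (F i)) ->
  cut_multiplier d (fun x => \prod_(i <- r | P i) F i x).
Proof.
move=> FP; elim: r => [|i r IH].
  apply: (eq_cut_multiplier _ (@cut_multiplier1 k d)) => x; by rewrite big_nil.
case Pi: (P i).
  apply: eq_cut_multiplier _ (cut_multiplierM (FP i Pi) IH) => x.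
  by rewrite big_cons Pi.
by apply: eq_cut_multiplier _ IH => x; rewrite big_cons Pi.
Qed.

Lemma cut_multiplier_avg k d (T : finType) (t0 : T) (F : T -> X k -> R) :
  (forall t, cut_multiplier d (F t)) -> cut_multiplier d (fun x => avg (F^~ x)).
Proof.
move=> FP W M WM u uP.
rewrite (eq_avg (g := fun x => avg (fun t => W x * F t x * cut_prod d u x))).
  by rewrite exchange_avg; apply: (norm_avg_le t0) => t; apply: FP.
by move=> x; rewrite avgZr avgZl.
Qed.

Lemma subset_of_card (T : finType) (B : {set T}) d : (#|B| <= d <= #|T|)%N ->
  exists2 B' : {set T}, B \subset B' & #|B'| = d.
Proof.
case/andP; elim: d => [|d IH].
  by rewrite leqn0 => /eqP B0 _; exists B.
rewrite leq_eqVlt ltnS => /orP[/eqP Bd _|Bd dT]; first by exists B.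
have [B' BB' cB'] := IH Bd (ltnW dT).
have /card_gt0P[x xB'] : (0 < #|~: B'|)%N by have := cardsC B'; lia.
exists (x |: B'); first by apply: subset_trans BB' (subsetUr _ _).
by rewrite cardsU1 cB'; move: xB'; rewrite inE => ->.
Qed.

(** The function [v] is absorbed into the factor [u B'] of some [d]-set [B'] containing [B]. *)
Lemma cut_multiplier_cylinder k d (B : {set 'I_k}) (v : X k -> R) :
  (#|B| <= d <= k)%N -> cylinder B v -> (forall x, `|v x| <= 1) -> cut_multiplier d v.
Proof.
move=> Bd vB v1 W M WM u uP.
have [|B' /subsetP BB' cB'] := @subset_of_card _ B d; first by rewrite card_ord.
pose u' (C : {set 'I_k}) x := if C == B' then v x * u C x else u C x.
have u'P : cut_functions d u'.
  move=> C cC; have [uc ub] := uP C cC; rewrite /u'; case: eqP => [CB'|//]; split.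
    move=> x y xy; rewrite (uc x y) // (vB x y) // => i iB.
    by apply: xy; rewrite CB' BB'.
  by move=> x; rewrite normrM mulr_ile1.
rewrite (eq_avg (g := fun x => W x * cut_prod d u' x)); first exact: WM.
move=> x; rewrite -mulrA; congr (_ * _).
rewrite /cut_prod (bigD1 B') ?cB' //= [RHS](bigD1 B') ?cB' //= mulrA /u' eqxx.
by congr (_ * _); apply: eq_bigr => C /andP[_ /negPf ->].
Qed.

(** Allowing every [c] absorbs the translations by [cube w h] inside a dual function. *)
Definition structured k d (I : {set 'I_k}) (g : G -> R) : Prop :=
  forall c, cut_multiplier d (fun x : X k => g (c + \sum_(i in I) x i)).

Lemma structured_small k d (I : {set 'I_k}) (g : G -> R) :
  (#|I| <= d <= k)%N -> (forall y, `|g y| <= 1) -> structured d I g.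
Proof.
move=> Id g1 c; apply: (cut_multiplier_cylinder Id) => // x y xy.
by congr (g (_ + _)); apply: eq_bigr.
Qed.

Lemma structured_correlation k d (g f : G -> R) M : (0 < k)%N ->
  structured d [set: 'I_k] g ->
  (forall u, cut_functions d u ->
     `|avg (fun x : X k => f (\sum_i x i) * cut_prod d u x)| <= M) ->
  `|avg (fun y => f y * g y)| <= M.
Proof.
move=> k0 gS fM; rewrite -(avg_sum_coord (Ordinal k0)).
have u1 : cut_functions (k := k) d (fun _ _ => 1) by split=> // x; rewrite normr1.
have := gS 0 _ _ fM _ u1; congr (`|_| <= _); apply: eq_avg => x /=.
rewrite /cut_prod [Z in _ * Z = _]big1 // mulr1 add0r; congr (_ * g _).
by apply: eq_bigl => i; rewrite inE.
Qed.

Definition dual m (F : {ffun 'I_m -> bool} -> G -> R) (c : G) : R :=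
  avg (fun h => \prod_(w | w != [ffun _ => false]) F w (c + cube w h)).

Lemma structured_dual k m d (p : 'I_k -> 'I_m) (I : {set 'I_k})
    (F : {ffun 'I_m -> bool} -> G -> R) :
  (forall w, w != [ffun _ => false] ->
     structured d [set i in I | ~~ w (p i)] (F w)) ->
  structured d I (dual F).
Proof.
move=> FP c.
have := cut_multiplier_avg [ffun _ : 'I_m => 0 : G] (fun h =>
  cut_multiplier_prod (index_enum _) (fun w wn => FP w wn (c + cube w h))).
apply: eq_cut_multiplier => x; rewrite /dual.
pose y (h : {ffun 'I_m -> G}) : {ffun 'I_m -> G} :=
  [ffun j => h j - \sum_(i in I | p i == j) x i].
rewrite [RHS](reindex_avg (h := y)); last first.
  exists (fun h : {ffun 'I_m -> G} => [ffun j => h j + \sum_(i in I | p i == j) x i]) => h;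
  by apply/ffunP=> j; rewrite !ffunE ?subrK ?addrK.
apply: eq_avg => h /=; apply: eq_bigr => w _; congr (F w _).
(* The subtracted terms cancel the [x i] with [w (p i)], so [F w] sees only the coordinates on which
   it is structured. *)
have -> : cube w (y h) = cube w h - \sum_(i in I | w (p i)) x i.
  rewrite /cube (partition_big p w) /=; last by move=> i /andP[].
  rewrite [Z in _ - Z]big_mkcond -sumrB; apply: eq_bigr => j _.
  rewrite ffunE; case wj: (w j); rewrite ?subr0 //; congr (_ - _).
  by apply: eq_bigl => i; case: eqP => [->|]; rewrite ?wj ?andbT ?andbF.
rewrite [\sum_(i in I) x i](bigID (fun i => w (p i))) /=.
rewrite (eq_bigl (fun i => (i \in I) && ~~ w (p i))); last by move=> i; rewrite inE.
rewrite -!addrA; congr (_ + _).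
by rewrite [Z in _ = _ + Z]addrA [RHS]addrC subrK addrC.
Qed.

Lemma dual_bounded m (F : {ffun 'I_m -> bool} -> G -> R) :
  (forall w y, `|F w y| <= 1) -> forall y, `|dual F y| <= 1.
Proof.
move=> F1 y; apply: (norm_avg_le [ffun _ => 0]) => h.
exact: bounded_prod.
Qed.

Lemma gform_dual m (F : {ffun 'I_m -> bool} -> G -> R) :
  gform F = avg (fun y => F [ffun _ => false] y * dual F y).
Proof.
apply: eq_avg => y; rewrite -avgZl; apply: eq_avg => h.
rewrite (bigD1 [ffun _ => false]) //= /cube; congr (F _ _ * _).
by rewrite big1 ?addr0 // => i _; rewrite ffunE.
Qed.

(** With [d + 1] coordinates and [p = id], each nonzero [w] leaves at most [d] of them, so every
    bounded family has a structured dual function and [cut_prod_le_gowers] applies. *)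
Lemma dual_le_gowers d (f : G -> R) (F : {ffun 'I_d.+1 -> bool} -> G -> R) :
  (forall w y, `|F w y| <= 1) ->
  `|avg (fun y => f y * dual F y)| <= gowers d.+1 f.
Proof.
move=> F1; apply: (@structured_correlation d.+1 d) => //; last first.
  by move=> u uP; apply: cut_prod_le_gowers.
apply: (structured_dual (p := id)) => w wn; apply: structured_small => //.
rewrite leqnSn andbT -ltnS -[Z in (_ < Z)%N]card_ord -cardsT proper_card //.
apply/properP; split; first by apply/subsetP => i; rewrite inE.
have [i wi] := cube_neq0 wn.
by exists i; rewrite !inE // wi.
Qed.

End CutFunctions.

(** * Counting the exponents *)

Section Exponents.

(* Bernoulli's inequality for [(1 - 1 / M.+1) ^ j], cleared of denominators. *)
Lemma bernoulli_nat (M j : nat) : (M.+1 ^ j * (M.+1 - j) <= M ^ j * M.+1)%N.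
Proof.
elim: j => [|j IH]; first by rewrite !expn0 !mul1n subn0.
have [jM|jM] := leqP M.+1 j.+1.
  by rewrite (_ : M.+1 - j.+1 = 0)%N ?muln0 //; lia.
rewrite !expnS; apply: leq_trans (_ : M.+1 ^ j * (M * (M.+1 - j)) <= _)%N; last first.
  by rewrite mulnCA -mulnA leq_mul2l IH orbT.
rewrite [(M.+1 * _)%N]mulnC -mulnA leq_mul2l; apply/orP; right.
have -> : (M.+1 - j.+1 = M - j)%N by lia.
have -> : (M.+1 - j = (M - j).+1)%N by lia.
by rewrite mulSn mulnS leq_add2r leq_subr.
Qed.

(** Each summand is the cost of one vertex, zero when its last bit is set. Over all [w] the products
    sum to [M * M.+1 ^ d], less than [2 * M ^ d.+1] by Bernoulli as [2 * d <= M]; removing the zero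
    vertex subtracts [M ^ d.+1]. *)
Lemma sum_subcube_le (M d K : nat) : (2 * d <= M)%N -> (0 < M)%N -> (d < K)%N ->
  (\sum_(w : {ffun 'I_d.+1 -> bool} | w != [ffun _ => false])
     M ^ (K - d.+1) * \prod_i (if w i then (i != ord_max : nat) else M)
   <= M ^ K - 1)%N.
Proof.
move=> dM M0 dK.
have H : (M.+1 ^ d < 2 * M ^ d)%N.
  have := bernoulli_nat M d; have : (0 < M ^ d)%N by rewrite expn_gt0 M0.
  move: (M ^ d)%N (M.+1 ^ d)%N => b c b0 bc; rewrite ltnNge; apply/negP => cb.
  have : (c * M.+2 <= c * (2 * (M.+1 - d)))%N by rewrite leq_mul2l; lia.
  have : (2 * b * M.+2 <= c * M.+2)%N by rewrite leq_mul2r cb orbT.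
  by rewrite mulnCA; lia.
have tot : (\sum_(w : {ffun 'I_d.+1 -> bool})
    \prod_i (if w i then (i != ord_max : nat) else M) = M * M.+1 ^ d)%N.
  rewrite -(bigA_distr_bigA (fun i (b : bool) => if b then (i != ord_max : nat) else M)).
  under eq_bigr do rewrite big_bool /=.
  rewrite big_ord_recr /= eqxx add0n mulnC; congr (_ * _)%N.
  rewrite -[in RHS](card_ord d) -prod_nat_const; apply: eq_bigr => i _.
  rewrite (_ : _ != _ = true) ?add1n // -val_eqE /=.
  by rewrite neq_ltn ltn_ord.
move: tot; rewrite (bigD1 [ffun _ => false]) //= -big_distrr /=.
under eq_bigr do rewrite ffunE.
rewrite prod_nat_const card_ord; set S := (\sum_(w | _) _)%N => tot.
have -> : (M ^ K = M ^ (K - d.+1) * M ^ d.+1)%N by rewrite -expnD subnK.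
have : (0 < M ^ (K - d.+1))%N by rewrite expn_gt0 M0.
move: tot H; rewrite expnS; move: (M ^ _)%N (M ^ _)%N (M.+1 ^ _)%N => a b c tot cb a0.
have SM : (S < M * b)%N.
  have : (M * c < M * b + M * b)%N by rewrite addnn -mul2n mulnCA ltn_mul2l M0 cb.
  by rewrite -tot ltn_add2l.
have : (a * S < a * (M * b))%N by rewrite ltn_mul2l a0 SM.
by case: (a * (M * b))%N => // n; rewrite subn1.
Qed.

End Exponents.

(** * Labelling coordinates by cube directions *)

Section Labels.
Variables (k d : nat) (I : {set 'I_k}).
Hypothesis dI : (d < #|I|)%N.

(** The first [d] elements of [I] get distinct labels; [minn] gives all later ones the last label
    [d]. *)
Definition label (i : 'I_k) : 'I_d.+1 := inord (minn (index i (enum I)) d).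

Lemma label_surj j : exists2 i, i \in I & label i = j.
Proof.
have jI : (j < size (enum I))%N by rewrite -cardE; apply: leq_ltn_trans dI; rewrite -ltnS.
have [i0 _] : exists i, i \in I by apply/card_gt0P; apply: leq_ltn_trans dI.
exists (nth i0 (enum I) j); first by rewrite -mem_enum mem_nth.
rewrite /label index_uniq ?enum_uniq //.
have -> : minn j d = j by apply/minn_idPl; rewrite -ltnS.
by rewrite inord_val.
Qed.

(** By surjectivity of the labelling, each set bit of [w] removes at least one element of [I]. *)
Lemma card_unlabelled (w : {ffun 'I_d.+1 -> bool}) :
  (#|[set i in I | ~~ w (label i)]| + #|[set j | w j]| <= #|I|)%N.
Proof.
rewrite -[leqRHS](cardsID [set i | w (label i)] I) addnC leq_add //.
  apply: leq_trans (leq_imset_card label _); apply/subset_leq_card/subsetP => j.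
  rewrite inE => wj; have [i iI ij] := label_surj j.
  by apply/imsetP; exists i; rewrite // !inE iI ij.
by apply/subset_leq_card/subsetP => i; rewrite !inE andbC.
Qed.

(** Setting the last bit removes the whole large fibre, leaving only elements among the first
    [d]. *)
Lemma card_unlabelled_last (w : {ffun 'I_d.+1 -> bool}) :
  w ord_max -> (#|[set i in I | ~~ w (label i)]| <= d)%N.
Proof.
move=> wm; apply: leq_trans (_ : #|take d (enum I)| <= _)%N; last first.
  by apply: leq_trans (card_size _) _; rewrite size_take_min geq_minl.
apply/subset_leq_card/subsetP => i; rewrite inE => /andP[iI wi].
rewrite in_take ?mem_enum // ltnNge; apply: contra wi => di.
by rewrite (_ : label i = ord_max) //; apply: val_inj; rewrite /= inordK (minn_idPr di).
Qed.

End Labels.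

(** * Moving a cube vertex to the origin *)

Section Twist.
Variables (R : realType) (G : finZmodType) (m : nat).
Local Notation W := {ffun 'I_m -> bool}.
Implicit Types F : W -> G -> R.

Definition xorw (w0 w : W) : W := [ffun i => w0 i (+) w i].

Lemma xorwK w0 : involutive (xorw w0).
Proof. by move=> w; apply/ffunP => i; rewrite !ffunE addbA addbb. Qed.

Lemma xorw0 w0 : xorw w0 [ffun _ => false] = w0.
Proof. by apply/ffunP => i; rewrite !ffunE addbF. Qed.

(** Flipping bits amounts to negating [h i] in the flipped directions and translating [x] by
    [cube w0 h]. *)
Lemma gform_xorw w0 F : gform (fun w => F (xorw w0 w)) = gform F.
Proof.
pose y (h : {ffun 'I_m -> G}) : {ffun 'I_m -> G} :=
  [ffun i => if w0 i then - h i else h i].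
have yK : involutive y.
  by move=> h; apply/ffunP => i; rewrite !ffunE; case: (w0 i); rewrite ?opprK.
have cubeE w h : cube (xorw w0 w) (y h) = cube w h - cube w0 h.
  rewrite /cube -sumrB; apply: eq_bigr => i _; rewrite !ffunE.
  by case: (w0 i); case: (w i); rewrite ?subr0 ?subrr ?add0r.
rewrite /gform [RHS]exchange_avg [RHS](reindex_avg (h := y)); last exact: inv_bij.
rewrite [LHS]exchange_avg; apply: eq_avg => h /=.
rewrite -[RHS](avg_shift _ (cube w0 h)); apply: eq_avg => x.
rewrite [RHS](reindex_inj (inv_inj (xorwK w0))) /=; apply: eq_bigr => w _.
by rewrite cubeE -[x + _ + _]addrA [cube w0 h + _]addrC subrK.
Qed.

Lemma gform_le1 F : (forall w y, `|F w y| <= 1) -> gform F <= 1.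
Proof.
move=> F1; apply: le_trans (ler_norm _) _; apply: (norm_avg_le (0 : G)) => x.
by apply: (norm_avg_le [ffun _ => 0]) => h; apply: bounded_prod.
Qed.

Definition upd F (w0 : W) (g : G -> R) (w : W) : G -> R := if w == w0 then g else F w.

Lemma gform_upd w0 F g :
  gform (upd F w0 g) = avg (fun y => g y * dual (fun w => F (xorw w0 w)) y).
Proof.
rewrite -(gform_xorw w0) gform_dual xorw0 /upd eqxx.
apply: eq_avg => y; congr (_ * _); apply: eq_avg => h; apply: eq_bigr => w wn.
have -> // : (xorw w0 w == w0) = false.
by rewrite -{2}(xorw0 w0) (inj_eq (inv_inj (xorwK w0))) (negPf wn).
Qed.

Lemma gform_upd_id w0 F : gform (upd F w0 (F w0)) = gform F.
Proof.
apply: eq_avg => x; apply: eq_avg => h; apply: eq_bigr => w _.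
by rewrite /upd; case: eqP => [->|].
Qed.

End Twist.

(** * Replacing cube factors by structured functions *)

Section Structure.
Variables (R : realType) (G : finZmodType) (d : nat).
Local Notation W := {ffun 'I_d.+1 -> bool}.
Local Notation gnorm f := (gform (m := d.+1) (fun _ => f)).

(** Taking every [v j] equal to 1 in [gform_dominates] bounds the form below by an even power. *)
Lemma gform_ge0 (f : G -> R) : 0 <= gnorm f.
Proof.
have := @gform_dominates R G d.+1 (enum 'I_d.+1) f (fun _ _ => 1) isT.
rewrite size_enum_ord => /(_ _ _) D; apply: le_trans (D _ _) => //.
  by rewrite expnS exprM exprn_ge0 ?sqr_ge0.
by move=> *; rewrite normr1.
Qed.

Lemma gowers_pow (f : G -> R) : gowers d.+1 f ^+ (2 ^ d.+1) = gnorm f.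
Proof.
rewrite /gowers -/(gnorm f) -powR_mulrn ?powR_ge0 // -powRrM mulVf ?powRr1 //.
  exact: gform_ge0.
by rewrite pnatr_eq0 expn_eq0.
Qed.

(* The dual function [H] of [F] at [w0] has [<F w0, H> = gform F], so it correlates
   with itself; being a dual function it then has a large uniformity norm. *)
Lemma gform_replace (F : W -> G -> R) (w0 : W) e (Q : (G -> R) -> Prop) :
  (forall w y, `|F w y| <= 1) -> 0 <= gform F ->
  (forall H : G -> R, (forall y, `|H y| <= 1) ->
     exists g, Q g /\ gnorm H ^+ (2 ^ e) <= avg (fun y => H y * g y)) ->
  exists g, Q g /\ gform F ^+ (2 ^ (d + 2 + e)) <= gform (upd F w0 g).
Proof.
move=> F1 F0 HQ; pose F' w := F (xorw w0 w).
have F'1 w y : `|F' w y| <= 1 by apply: F1.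
have [g [Qg Hg]] := HQ (dual F') (dual_bounded F'1); exists g; split=> //.
rewrite gform_upd (eq_avg (g := fun y => dual F' y * g y)); last by move=> y; rewrite mulrC.
(* Of the exponent [d + 2], one comes from Cauchy-Schwarz against [F w0] and [d + 1] from the power
   relating [gowers] to [gform]. *)
apply: le_trans Hg; rewrite expnD exprM lerXn2r ?nnegrE ?exprn_ge0 ?gform_ge0 //.
rewrite -gowers_pow addn2 expnS exprM lerXn2r ?nnegrE ?sqr_ge0 ?powR_ge0 //.
apply: le_trans (le_trans (ler_norm _) (dual_le_gowers (dual F') F'1)).
rewrite -(gform_upd_id w0) gform_upd.
exact: (sqr_avgM_le (0 : G) (dual F') (F1 w0)).
Qed.

Lemma structured_correlate k (I : {set 'I_k}) (f : G -> R) : (d < #|I|)%N ->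
  (forall y, `|f y| <= 1) ->
  exists g, (structured d I g /\ forall y, `|g y| <= 1) /\
    gnorm f ^+ (2 ^ ((d + 2) * ((2 * d + 2) ^ #|I| - 1))) <= avg (fun y => f y * g y).
Proof.
set M := (2 * d + 2)%N.
have [n] := ubnP #|I|; elim: n I f => // n IH I f In dI f1.
have M0 : (0 < M)%N by rewrite /M addn2.
have dk : (d <= k)%N by apply: leq_trans (ltnW dI) _; rewrite -[leqRHS]card_ord max_card.
have f_le1 : gnorm f <= 1 by apply: gform_le1.
pose J (w : W) := [set i in I | ~~ w (label d I i)].
(* If the last bit of [w] is unset this is [M] to the power [#|I|] minus the number of set bits, an
   upper bound for [M ^ #|J w|]; otherwise it is 0. *)
pose cost (w : W) := (M ^ (#|I| - d.+1) * \prod_i (if w i then (i != ord_max : nat) else M))%N.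
pose w00 : W := [ffun _ => false].
have sizeJ w : w != w00 -> (#|J w| < #|I|)%N.
  move=> wn; apply: leq_trans (card_unlabelled dI w).
  rewrite -[ltnLHS]addn0 ltn_add2l.
  by have [i wi] := cube_neq0 wn; apply/card_gt0P; exists i; rewrite inE.
have costJ w : (d < #|J w|)%N -> (M ^ #|J w| <= cost w)%N.
  move=> dJ; have wm : ~~ w ord_max.
    by apply: contraL dJ => wm; rewrite -leqNgt; apply: card_unlabelled_last.
  have -> : cost w = (M ^ (#|I| - d.+1) * M ^ (d.+1 - #|[set j | w j]|))%N.
    congr (_ * _)%N; rewrite (bigID w) /= big1; last first.
      by move=> i wi; rewrite wi; case: eqP wi wm => // -> ->.
    rewrite mul1n (eq_bigr (fun _ => M)); last by move=> i /negbTE ->.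
    rewrite prod_nat_const; congr (_ ^ _)%N.
    have := cardsC [set j | w j]; rewrite card_ord => /(canRL (addKn _)) <-.
    by apply: eq_card => i; rewrite !inE.
  rewrite -expnD leq_exp2l; last by rewrite /M; lia.
  rewrite addnBA; last by rewrite -[leqRHS](card_ord d.+1) max_card.
  have H := card_unlabelled dI w.
  rewrite subnK // leq_subRL; first by rewrite addnC.
  exact: leq_trans (leq_addl _ _) H.
have [F [F0 F1 FJ FT]] : exists F : W -> G -> R,
    [/\ F w00 = f, forall w y, `|F w y| <= 1,
      forall w, w \in [seq w <- index_enum W | w != w00] -> structured d (J w) (F w) &
      gnorm f ^+ (2 ^ (\sum_(w <- [seq w <- index_enum W | w != w00]) (d + 2) * cost w))
        <= gform F].
  have : all (fun w => w != w00) [seq w <- index_enum W | w != w00] by rewrite filter_all.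
  elim: [seq _ <- _ | _] => [_|w0 s IHs /= /andP[w0n /IHs[F [F0 F1 FJ FT]]]].
    by exists (fun _ => f); rewrite big_nil expn0 expr1.
  have Fge0 : 0 <= gform F by apply: le_trans FT; rewrite exprn_ge0 ?gform_ge0.
  have [g [[gJ g1] gT]] : exists g, (structured d (J w0) g /\ forall y, `|g y| <= 1) /\
      gform F ^+ (2 ^ ((d + 2) * cost w0)) <= gform (upd F w0 g).
    (* When [J w0] has at most [d] elements, [F w0] is already structured and is kept. *)
    have [dJ|Jd] := ltnP d #|J w0|; last first.
      exists (F w0); split; first by split=> //; apply: structured_small; rewrite // Jd.
      by rewrite gform_upd_id ler_iXnr ?expn_gt0 ?gform_le1.
    have Jn : (#|J w0| < n)%N by apply: leq_trans (sizeJ w0 w0n) _; rewrite -ltnS.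
    have [g [gQ gT]] := gform_replace w0 F1 Fge0 (fun H => IH (J w0) H Jn dJ).
    exists g; split=> //; apply: le_trans gT.
    (* The [- 1] in the inductive exponent exactly absorbs the [d + 2] spent on one replacement. *)
    rewrite ler_wiXn2l ?gform_le1 // leq_exp2l //.
    rewrite -{1}[(d + 2)%N]muln1 -mulnDr leq_mul2l subnKC ?expn_gt0 ?M0 //.
    by rewrite costJ ?orbT.
  exists (upd F w0 g); split.
  - by rewrite /upd eq_sym (negPf w0n).
  - by move=> w y; rewrite /upd; case: eqP.
  - move=> w; rewrite inE /upd; case: eqP => [-> //|_ /=]; exact: FJ.
  - apply: le_trans gT; rewrite big_cons addnC expnD exprM.
    by rewrite lerXn2r ?nnegrE ?exprn_ge0 ?gform_ge0.
(* The factor at the zero vertex is still [f], so the final form is the correlation of [f] with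
   [dual F]. *)
exists (dual F); split; first split; last 1 first.
- have -> : avg (fun y => f y * dual F y) = gform F by rewrite gform_dual -F0.
  apply: le_trans FT.
  rewrite ler_wiXn2l ?gform_ge0 //.
  rewrite leq_exp2l // -big_distrr leq_mul2l big_filter; apply/orP; right.
  by apply: sum_subcube_le; rewrite // /M; lia.
- apply: (structured_dual (p := label d I)) => w wn; apply: FJ.
  by rewrite mem_filter wn mem_index_enum.
- exact: dual_bounded.
Qed.

End Structure.

(** * From bounded cut functions to sets *)

Section CutNorm.
Variables (R : realType) (G : finZmodType) (k : nat).
Local Notation X := {ffun 'I_k -> G}.

(* A linear functional of a bounded function on [G^B] is maximised by a sign. *)
Lemma cylinder_sign (B : {set 'I_k}) (u V : X -> R) :
  cylinder B u -> (forall x, `|u x| <= 1) ->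
  exists2 S : {set X}, cylinder B (fun x => (x \in S)%:R : R) &
    `|avg (fun x => u x * V x)| <=
    `|avg (fun x => (x \in S)%:R * V x)| + `|avg (fun x => (x \notin S)%:R * V x)|.
Proof.
(* Zeroing the coordinates outside [B] picks a representative of each class of points agreeing on
   [B]; [w z] sums [V] over such a class. *)
move=> uB u1; pose r (x : X) : X := [ffun i => if i \in B then x i else 0].
have rE (x y : X) : (forall i, i \in B -> x i = y i) -> r x = r y.
  by move=> xy; apply/ffunP => i; rewrite !ffunE; case: ifP => // /xy.
pose w z := \sum_(x | r x == z) V x.
have sumE (v : X -> R) : (forall x, v x = v (r x)) ->
    \sum_x v x * V x = \sum_z v z * w z.
  move=> vr; rewrite (partition_big r xpredT) //=; apply: eq_bigr => z _.
  by rewrite mulr_sumr; apply: eq_bigr => x /eqP <-; rewrite -vr.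
have rr x : r (r x) = r x by apply: rE => i iB; rewrite ffunE iB.
pose S := [set x | 0 <= w (r x)].
exists S => [x y /rE xy|]; first by rewrite !inE xy.
have ux x : u x = u (r x) by apply: uB => i iB; rewrite ffunE iB.
have Sx x : (x \in S)%:R = (r x \in S)%:R :> R by rewrite !inE rr.
have nSx x : (x \notin S)%:R = (r x \notin S)%:R :> R by rewrite !inE rr.
have Sw z : `|u z * w z| <= (z \in S)%:R * w z - (z \notin S)%:R * w z.
  have [rz|rz] := eqVneq (r z) z; last first.
    rewrite /w big1 ?mulr0 ?normr0 ?subrr // => x /eqP xz.
    by move: rz; rewrite -xz rr eqxx.
  rewrite normrM inE rz; case: (leP 0 (w z)) => wz /=.
    by rewrite mul1r mul0r subr0 [`|w z|]ger0_norm // ler_piMl.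
  by rewrite mul0r mul1r sub0r [`|w z|]ltr0_norm // ler_piMl // oppr_ge0 ltW.
rewrite /avg !normrM !sumE // -mulrDr ler_wpM2l //.
apply: le_trans (ler_norm_sum _ _ _) (le_trans (ler_sum _ (fun z _ => Sw z)) _).
by rewrite sumrB (le_trans (ler_norm _)) // ler_normB.
Qed.

Lemma cutnorm_ge0 d (f : X -> R) : 0 <= cutnorm d f.
Proof. exact: bigmax_ge_id. Qed.

(** Factors become indicators one at a time. Each replacement splits into a set and its complement,
    costing a factor 2, and there are [2 ^ k] sets [B] in all. *)
Lemma cut_functions_le_cutnorm d (f : X -> R) u : cut_functions d u ->
  `|avg (fun x => f x * cut_prod d u x)| <= 2 ^+ (2 ^ k) * cutnorm d f.
Proof.
move=> uP; have -> : (2 ^ k = size (enum {set 'I_k}))%N.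
  by rewrite -cardE -cardsT -powersetT card_powerset cardsT card_ord.
(* Invariant for the induction: factors at [d]-sets outside the list are already indicators. *)
have : forall B : {set 'I_k}, #|B| = d -> B \notin enum {set 'I_k} ->
    exists S : {set X}, forall x, u B x = (x \in S)%:R.
  by move=> B _; rewrite mem_enum.
elim: (enum _) u uP => [|B s IH] u uP uS.
  rewrite expr0 mul1r.
  pose S := [ffun B : {set 'I_k} => [set x | u B x == 1]].
  have SE (B : {set 'I_k}) x : #|B| = d -> u B x = (x \in S B)%:R.
    move=> cB; have [T uT] := uS B cB isT; rewrite ffunE inE uT.
    by case: (x \in T); rewrite ?eqxx // eq_sym oner_eq0.
  have SP : cut_family d S.
    apply/forallP => B; apply/implyP => /eqP cB.
    apply/forallP => x; apply/forallP => y; apply/implyP => /forallP xy.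
    have [uc _] := uP B cB; rewrite !ffunE !inE (uc x y) => [|i iB]; first exact: eqxx.
    by have := xy i; rewrite iB => /eqP.
  rewrite (eq_avg (g := fun x => f x * \prod_(B : {set 'I_k} | #|B| == d) (x \in S B)%:R)).
    exact: (le_bigmax_cond _ (fun S : {ffun {set 'I_k} -> {set X}} => _)).
  by move=> x; congr (_ * _); apply: eq_bigr => B /eqP cB; apply: SE.
have [cB|cB] := eqVneq #|B| d; last first.
  apply: le_trans (IH u uP _) _ => [C cC Cs|].
    by apply: uS => //; rewrite inE negb_or Cs andbT; apply: contraNneq cB => <-; rewrite cC.
  by rewrite ler_wpM2r ?cutnorm_ge0 // ler_eXn2l ?ltr1n.
have [uB u1] := uP B cB.
pose V x := f x * \prod_(C : {set 'I_k} | (#|C| == d) && (C != B)) u C x.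
have [S SB Sle] := cylinder_sign V uB u1.
pose u' (T : X -> R) C := if C == B then T else u C.
have u'E (T : X -> R) : avg (fun x => f x * cut_prod d (u' T) x) = avg (fun x => T x * V x).
  apply: eq_avg => x; rewrite /cut_prod (bigD1 B) ?cB //= /u' eqxx mulrCA.
  by congr (_ * (_ * _)); apply: eq_bigr => C /andP[_ /negPf ->].
have le' (T : {set X}) : cylinder B (fun x => (x \in T)%:R : R) ->
    `|avg (fun x => (x \in T)%:R * V x)| <= 2 ^+ size s * cutnorm d f.
  move=> TB; rewrite -(u'E (fun x => (x \in T)%:R)); apply: IH => [C cC|C cC Cs].
    rewrite /u'; case: eqP => [->|_]; last exact: uP.
    by split=> // x; case: (x \in T); rewrite ?normr1 ?normr0 ?ler01.
  rewrite /u'; case: eqP => [_|/eqP CB]; first by exists T.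
  by apply: uS; rewrite // inE negb_or CB.
have -> : avg (fun x => f x * cut_prod d u x) = avg (fun x => u B x * V x).
  rewrite -u'E; apply: eq_avg => x; congr (_ * _); apply: eq_bigr => C _.
  by rewrite /u'; case: eqP => [->|].
apply: le_trans Sle _; rewrite /= exprS -mulrA mulr_natl mulr2n lerD ?le' //.
have := le' (~: S); under eq_avg do rewrite inE; apply => x y xy; rewrite !inE.
have := SB x y xy; case: (x \in S); case: (y \in S) => // /eqP;
  by rewrite ?oner_eq0 // eq_sym oner_eq0.
Qed.

End CutNorm.

(** * Both directions for the balanced function *)

Lemma balanced_bounded (R : realType) (G : finZmodType) (A : {set G}) x :
  `|balanced R A x| <= 1.
Proof.
have d0 : 0 <= density R A by rewrite divr_ge0 ?ler0n.
have d1 : density R A <= 1.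
  rewrite ler_pdivrMr ?mul1r ?ler_nat ?max_card // ltr0n.
  by apply/card_gt0P; exists 0.
by rewrite /balanced ler_norml; case: (x \in A) => /=; apply/andP; split; lra.
Qed.

Theorem theorem3p1 (R : realType) (d : nat) (eps : R) (G : finZmodType)
    (A : {set G}) :
  (1 <= d)%N -> 0 < eps < 1 ->
  (forall k : nat, (d.+1 <= k)%N ->
     gowers d.+1 (balanced R A) <= eps ->
     cutnorm (k:=k) d (fun x => cayley R A x - density R A) <= eps)
  /\
  (forall k : nat, (d.+1 <= k)%N ->
     cutnorm (k:=k) d (fun x => cayley R A x - density R A) <= eps ->
     gowers d.+1 (balanced R A) <= 2 * powR eps (ckd R k d)).
Proof.
move=> _ /andP[eps0 eps1]; split=> k dk.
  move=> Ueps; apply: bigmax_le => [|S /forallP SP]; first exact: ltW.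
  apply: le_trans Ueps.
  apply: (@cut_prod_le_gowers _ _ k d (balanced R A) (fun B x => (x \in S B)%:R)) => //.
  move=> B cB; split=> [x y xy|x]; last by case: (x \in _); rewrite ?normr1 ?normr0 ?ler01.
  have /implyP/(_ (introT eqP cB))/forallP/(_ x)/forallP/(_ y) := SP B.
  move=> /implyP; case: forallP => [_ /(_ isT)/eqP -> //|[]] i.
  by apply/implyP => iB; apply/eqP/xy.
move=> Ceps; set U := gowers _ _.
have dI : (d < #|[set: 'I_k]|)%N by rewrite cardsT card_ord.
have [g [[gS _]]] := structured_correlate dI (@balanced_bounded R G A).
rewrite -gowers_pow -/U -exprM -expnD cardsT card_ord => Ug.
have Ule : U ^+ (2 ^ (d.+1 + (d + 2) * ((2 * d + 2) ^ k - 1))) <= 2 ^+ (2 ^ k) * eps.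
  apply: le_trans Ug (le_trans (ler_norm _) _).
  apply: (structured_correlation _ gS) => [|u uP]; first exact: leq_trans dk.
  apply: le_trans (cut_functions_le_cutnorm _ uP) _.
  by rewrite ler_wpM2l ?exprn_ge0 ?ler0n.
set E := ((d + 2) * (2 * d + 2) ^ k)%N.
have M0 : (0 < (2 * d + 2) ^ k)%N by rewrite expn_gt0 addn2.
have U0 : 0 <= U by apply: powR_ge0.
have U1 : U <= 1.
  rewrite -(expr_le1 (n := 2 ^ d.+1)) ?expn_gt0 // gowers_pow gform_le1 // => _ y.
  exact: balanced_bounded.
have ckdE : ckd R k d = (2 ^ E)%:R^-1 by rewrite /ckd -/E powR_invn ?ler0n // natrX.
have N0 : (0 < 2 ^ E)%N by rewrite expn_gt0.
have epsE : powR eps (ckd R k d) ^+ (2 ^ E) = eps.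
  rewrite -powR_mulrn ?powR_ge0 // -powRrM ckdE mulVf ?powRr1 ?(ltW eps0) //.
  by rewrite pnatr_eq0 -lt0n.
(* After raising to the power [2 ^ E], the leading 2 becomes [2 ^+ (2 ^ E)], which dominates
   [2 ^+ (2 ^ k)] because [k <= E]. *)
rewrite -(ler_pXn2r N0) ?nnegrE ?mulr_ge0 ?powR_ge0 ?ler0n // exprMn epsE.
apply: le_trans (_ : 2 ^+ (2 ^ k) * eps <= _); last first.
  rewrite ler_wpM2r ?(ltW eps0) // ler_weXn2l ?ler1n // leq_exp2l //.
  apply: leq_trans (_ : (2 * d + 2) ^ k <= _)%N; last by rewrite leq_pmull // addn2.
  by apply: ltnW; apply: ltn_expl; rewrite addn2.
(* As [U <= 1], it suffices to compare exponents; the saved [d + 2] pays for the [d.+1] from passing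
   to the norm. *)
apply: le_trans Ule; rewrite ler_wiXn2l // leq_exp2l // /E.
move: ((2 * d + 2) ^ k)%N M0 => [//|a] _; rewrite subn1 /= mulnS; lia.
Qed.
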